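(* Let $(S,d)$ be a complete separable metric space. Then $\mathcal{M}(S)$ is $\mathrm{U}_b(S)$-weakly sequentially complete; that is, if $(\mu_n)_{n\in\mathbb{N}}\subset\mathcal{M}(S)$ is a sequence such that $(\langle\mu_n,f\rangle)_n$ is a Cauchy sequence for every $f\in\mathrm{U}_b(S)$, then there exists $\mu\in\mathcal{M}(S)$ such that $\langle\mu_n,f\rangle\to\langle\mu,f\rangle$ for every $f\in\mathrm{U}_b(S)$.
   Context: $\mathcal{M}(S)$ is the space of finite signed Borel measures on $S$, $\mathrm{U}_b(S)$ is the Banach space of bounded uniformly continuous real-valued functions on $(S,d)$ with the norm $\|\cdot\|_\infty$, and $\langle\mu,f\rangle:=\int_S f\,d\mu$. *)

(* Defs.v *)
From HB Require Import structures.
From mathcomp Require Import all_boot all_order all_algebra.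
From mathcomp Require Import all_classical all_reals all_analysis.

Set Implicit Arguments.
Unset Strict Implicit.
Unset Printing Implicit Defensive.

Import Order.TTheory GRing.Theory Num.Theory.
Import numFieldNormedType.Exports.

Local Open Scope classical_set_scope.
Local Open Scope ring_scope.

(* Join of two library structures. [Complete] makes the type pointed, which
   [measurableType] also requires; the empty space is therefore excluded. *)
#[short(type="completeMetricType")]
HB.structure Definition CompleteMetric (K : numDomainType) :=
  {T of Metric K T & Complete T}.

Definition separable (T : topologicalType) :=
  exists2 D : set T, countable D & dense D.

Definition borel (T : ptopologicalType) := g_sigma_algebraType (@open T).

(* Charges are countably additive and finite on every measurable set. *)
Definition signed_measure (R : realType) (S : completeMetricType R) :=
  {charge set (borel S) -> \bar R}.

Section charge_integral.
Context d (T : measurableType d) (R : realType).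
Implicit Type nu : {charge set T -> \bar R}.

Definition hahn_pos nu : set T := projT1 (cid (Hahn_decomposition nu)).

Definition hahn_neg nu : set T :=
  projT1 (cid (projT2 (cid (Hahn_decomposition nu)))).

Lemma hahn_posneg nu : hahn_decomposition nu (hahn_pos nu) (hahn_neg nu).
Proof. exact: projT2 (cid (projT2 (cid (Hahn_decomposition nu)))). Qed.

(* Integral against a signed measure through its Jordan decomposition; by
   [charge_integralE] it does not depend on the chosen Hahn decomposition.
   [Rintegral] is [fine] of the extended-real integral, so the value is only
   meaningful when f is integrable for both parts. *)
Definition charge_integral nu (f : T -> R) : R :=
  \int[jordan_pos (hahn_posneg nu)]_x f x
  - \int[jordan_neg (hahn_posneg nu)]_x f x.

Lemma charge_integralE nu (f : T -> R) P N
    (nuPN : hahn_decomposition nu P N) :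
  charge_integral nu f =
  \int[jordan_pos nuPN]_x f x - \int[jordan_neg nuPN]_x f x.
Proof.
rewrite /charge_integral /Rintegral; congr (fine _ - fine _).
  apply: eq_measure_integral => A mA _ /=.
  rewrite !jordan_posE !cjordan_posE /crestr0 mem_set// /crestr/=.
  by have [] := Hahn_decomposition_uniq (hahn_posneg nu) nuPN mA.
apply: eq_measure_integral => A mA _ /=.
rewrite !jordan_negE !cjordan_negE /crestr0 mem_set// /crestr/=.
by have [_ ->] := Hahn_decomposition_uniq (hahn_posneg nu) nuPN mA.
Qed.

End charge_integral.

Definition pairing (R : realType) (S : completeMetricType R)
    (mu : signed_measure S) (f : S -> R) : R :=
  @charge_integral _ (borel S) R mu f.

Definition Ub (R : realType) (S : completeMetricType R) : set (S -> R) :=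
  [set f : S -> R | [bounded f x | x in setT] /\ unif_continuous f].
Arguments Ub {R} S.

(* Main.v *)
Require Import Defs.
From mathcomp Require Import all_boot all_order all_algebra.
From mathcomp Require Import all_classical all_reals all_analysis.
From mathcomp Require Import measurable_realfun ring lra.

Import Order.TTheory GRing.Theory Num.Theory.
Import numFieldNormedType.Exports.

Local Open Scope classical_set_scope.
Local Open Scope ring_scope.

(** The limit L f of the sequence <mu_n, f> is a linear functional on U_b(S), and
    the point is to represent it by a measure. Three ideas carry the proof.

    Gliding humps. Let (h_j) be functions all of whose sub-sums belong to U_b(S)
    and converge boundedly. Then the matrix <mu_n, h_j> has, along every set of
    indices j, sums that converge in n, and Baire's argument on {0,1}^N shows
    that <mu_n, h_j> tends to 0 as j grows, uniformly in n
    ([subseries_uniformly_vanishing], [hump_uniformly_vanishing]). Applied to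
    f_j / 2^j with f_j in the unit ball, this bounds L ([limit_bounded]).
    Applied to equicontinuous functions with disjoint supports, it recovers
    enough countable additivity: S has partitions of unity (piece_i)
    subordinate to balls of a given radius, centred at a dense sequence, with
    L f = sum_i L (f * piece_i) ([limit_piece_series]).

    A tree of small supports. Multiplying such partitions of unity for the radii
    1, 1/2, 1/4, ... gives functions node s indexed by finite sequences s of
    integers, and L (f * node s) = sum_i L (f * node (i :: s)). The total
    variation |L| (node s), a supremum of L g over |g| <= node s, is additive
    along the tree as well ([functional_variation_series]), and so is the
    nonnegative difference |L| - L.

    Coding. A nonnegative additive weight on the tree is the length of nested
    intervals. A real number in the root interval follows a branch of the tree,
    the supports along this branch shrink to a point of S by completeness, and
    the image of Lebesgue measure under this map is a finite Borel measure
    compatible with the weight ([coded_measure_exists]). This construction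
    replaces a Riesz representation theorem. The difference of the measures
    obtained from |L| and from |L| - L represents L, as the oscillation of a
    uniformly continuous function on the supports of a deep level is small
    ([pairing_representation]). *)

Set Implicit Arguments.
Unset Strict Implicit.
Unset Printing Implicit Defensive.

(** * Series all of whose subseries converge *)

Section real_sequences.
Context {R : realType}.
Implicit Types (u v : nat -> R) (l : R).

Lemma cvgn_distP u l : u @ \oo --> l <->
  forall e, 0 < e -> exists N, forall n, (N <= n)%N -> `|u n - l| <= e.
Proof.
split=> [/cvgrPdist_le ul e e0|ul].
  by have [N _ uN] := ul _ e0; exists N => n Nn; rewrite distrC; exact: uN.
apply/cvgrPdist_le => e /ul[N uN]; exists N => // n Nn.
by rewrite distrC; exact: uN.
Qed.

Lemma cvgn_le u v l m : u @ \oo --> l -> v @ \oo --> m ->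
  (forall n, u n <= v n) -> l <= m.
Proof.
move=> ul vm uv; rewrite -(cvg_lim _ ul)// -(cvg_lim _ vm)//.
by apply: ler_lim; [exact: cvgP ul|exact: cvgP vm|exact: nearW].
Qed.

Lemma cvgn_norm_le u l B : u @ \oo --> l -> (forall n, `|u n| <= B) -> `|l| <= B.
Proof.
move=> ul uB; apply: (@cvgn_le (fun n => `|u n|) (fun=> B)) => //.
  exact: cvg_norm.
exact: cvg_cst.
Qed.

Lemma series0 u : series u 0 = 0.
Proof. by rewrite /series/= big_geq. Qed.

Section subseries.
Variables (a : nat -> nat -> R) (T : nat -> (nat -> bool) -> R).
Hypothesis aT : forall n (c : nat -> bool),
  series (fun j => (c j)%:R * a n j) @ \oo --> T n c.

(** Convergence of all subseries forces absolute convergence, so the sum over a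
    subset depends continuously on the subset, for the topology of {0,1}^N. *)
Lemma subseries_continuous n (e : R) : 0 < e ->
  exists K, forall c c' : nat -> bool, (forall j, (j < K)%N -> c j = c' j) ->
    `|T n c - T n c'| <= e.
Proof.
move=> e0.
have : cvgn (series (fun j => `|a n j|)).
  have -> : series (fun j => `|a n j|) =
     (fun N => 2 * series (fun j => (0 < a n j)%R%:R * a n j) N
       - series (fun j => true%:R * a n j) N).
    apply/funext => N; elim: N => [|N IH]; first by rewrite !series0; lra.
    rewrite !seriesSr IH; have [a0|a0] := ltP 0 (a n N).
      by rewrite gtr0_norm// mul1r; lra.
    by rewrite ler0_norm// mul0r mul1r; lra.
  apply/cvg_ex; exists (2 * T n (fun j => 0 < a n j) - T n xpredT).
  apply: cvgB; last exact: (@aT n xpredT).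
  by apply: cvgM; [exact: cvg_cst|exact: (@aT n (fun j => 0 < a n j))].
move=> /cvg_ex[/= A /cvgn_distP /(_ (e / 2))]; have e20 : 0 < e / 2 by lra.
move=> /(_ e20)[K AK]; exists K => c c' cc'.
apply: (@cvgn_norm_le (fun N => series (fun j => (c j)%:R * a n j) N -
   series (fun j => (c' j)%:R * a n j) N)).
  by apply: cvgB; exact: aT.
move=> N.
have low m : (m <= K)%N -> series (fun j => (c j)%:R * a n j) m =
    series (fun j => (c' j)%:R * a n j) m.
  elim: m => [|m IH] mK; first by rewrite !series0.
  by rewrite !seriesSr IH ?cc'// ltnW.
have [NK|KN] := leqP N K; first by rewrite low// subrr normr0 ltW.
have high m : (K <= m)%N -> `|series (fun j => (c j)%:R * a n j) m -
    series (fun j => (c' j)%:R * a n j) m| <=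
    series (fun j => `|a n j|) m - series (fun j => `|a n j|) K.
  elim: m => [|m IH]; first by rewrite leqn0 => /eqP ->; rewrite !series0 !subrr normr0.
  rewrite leq_eqVlt => /predU1P[<-|Km]; first by rewrite low// !subrr normr0.
  rewrite !seriesSr.
  rewrite (_ : _ + _ - (_ + _) = (series (fun j => (c j)%:R * a n j) m -
    series (fun j => (c' j)%:R * a n j) m) + ((c m)%:R - (c' m)%:R) * a n m); last by ring.
  apply: (le_trans (ler_normD _ _)).
  have : `|((c m)%:R - (c' m)%:R) * a n m| <= `|a n m|.
    by case: (c m); case: (c' m); rewrite ?subrr ?subr0 ?sub0r ?mul0r ?mulN1r ?mul1r ?normrN ?normr0.
  by have := IH Km; lra.
apply: (le_trans (high _ (ltnW KN))).
have := AK _ (ltnW KN); have := AK _ (leqnn K).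
by rewrite !ler_norml; lra.
Qed.

Hypothesis cT : forall c, cvgn (T ^~ c).

(** Baire's argument on {0,1}^N: the subsets along which the sequence of sums
    varies by at most e from rank N on form closed sets covering the space as N
    grows, hence one of them contains a cylinder. Otherwise the prefixes
    (st k).2, frozen below (st k).1, could be extended forever so that the limit
    subset belongs to none of these sets. *)
Lemma subseries_cylinder (e : R) : 0 < e ->
  exists N K (c0 : nat -> bool), forall c : nat -> bool,
  (forall j, (j < K)%N -> c j = c0 j) -> forall n m, (N <= n)%N -> (N <= m)%N ->
    `|T n c - T m c| <= e.
Proof.
move=> e0; apply: contrapT => none.
have step (s : nat * (nat * (nat -> bool))) : exists t : nat * (nat -> bool),
    [/\ (s.2.1 < t.1)%N, (forall j, (j < s.2.1)%N -> t.2 j = s.2.2 j) &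
     forall c : nat -> bool, (forall j, (j < t.1)%N -> c j = t.2 j) ->
      exists n m, [/\ (s.1 <= n)%N, (s.1 <= m)%N & e < `|T n c - T m c|]].
  case: s => N [K c0] /=.
  have [c [cc0 [n [m [Nn Nm enm]]]]] : exists c : nat -> bool,
      (forall j, (j < K)%N -> c j = c0 j) /\
      exists n m, [/\ (N <= n)%N, (N <= m)%N & e < `|T n c - T m c|].
    apply: contrapT => no; apply: none; exists N, K, c0 => c cc0 n m Nn Nm.
    rewrite leNgt; apply/negP => enm; apply: no; exists c; split=> //.
    by exists n, m.
  (* two perturbations of size d keep the gap above e *)
  pose d := (`|T n c - T m c| - e) / 3.
  have d0 : 0 < d by rewrite divr_gt0// subr_gt0.
  have [K1 h1] := subseries_continuous n d0.
  have [K2 h2] := subseries_continuous m d0.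
  exists (maxn K.+1 (maxn K1 K2), c); split => //=; first by rewrite leq_max ltnSn.
  move=> c' cc'; exists n, m; split => //.
  have lt1 j : (j < K1)%N -> c j = c' j.
    by move=> jK; rewrite cc'// !leq_max jK orbT.
  have lt2 j : (j < K2)%N -> c j = c' j.
    by move=> jK; rewrite cc'// !leq_max jK !orbT.
  have := h1 _ _ lt1; have := h2 _ _ lt2.
  have -> : T n c' - T m c' = (T n c - T m c) - (T n c - T n c') + (T m c - T m c') by ring.
  move=> H2 H1; have := lerB_normD (T n c - T m c) (- (T n c - T n c') + (T m c - T m c')).
  have := ler_normD (- (T n c - T n c')) (T m c - T m c').
  by rewrite normrN !addrA; move: d0 H1 H2; rewrite /d; lra.
have {}step s := cid (step s).
pose st := fix st k := if k is k'.+1 then sval (step (k', st k')) else (0%N, xpredT).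
have Kst k : ((st k).1 < (st k.+1).1)%N by rewrite /=; case: (step _) => ? [].
have le_st k m : (k <= m)%N -> ((st k).1 <= (st m).1)%N.
  elim: m => [|m IH]; first by rewrite leqn0 => /eqP ->.
  rewrite leq_eqVlt => /predU1P[->//|km].
  by apply: leq_trans (IH km) _; exact/ltnW/Kst.
have ge_st k : (k <= (st k).1)%N.
  by elim: k => // k IH; exact: leq_ltn_trans IH (Kst k).
have agree k m j : (k <= m)%N -> (j < (st k).1)%N -> (st m).2 j = (st k).2 j.
  elim: m => [|m IH]; first by rewrite leqn0 => /eqP ->.
  rewrite leq_eqVlt => /predU1P[->//|km] jk; rewrite -IH//=.
  by case: (step _) => ? [/= _ + _]; apply; apply: leq_trans jk _; exact: le_st.
pose c j := (st j.+1).2 j.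
have c_st k j : (j < (st k).1)%N -> c j = (st k).2 j.
  move=> jk; rewrite /c; have [kj|jk'] := leqP k j.+1; first exact: agree.
  by apply/esym/agree; [exact: ltnW|exact: (ge_st j.+1)].
have /cvg_ex[/= l /cvgn_distP /(_ (e / 2))] := @cT c.
have e20 : 0 < e / 2 by lra.
move=> /(_ e20)[N hN].
have := c_st N.+1; rewrite /=; case: (step _) => t [/= _ _ + ct].
move=> /(_ c ct)[n [m [/hN Tn /hN Tm]]]; apply/negP; rewrite -leNgt.
by move: Tn Tm; rewrite !ler_norml; lra.
Qed.

(** Within the cylinder, a single index j beyond the prefix can be switched on or
    off, which compares a n j with a N j; only finitely many rows are left, and
    each of them tends to 0. This is the uniform smallness of tails that makes
    l^1 weakly sequentially complete. *)
Lemma subseries_uniformly_vanishing (e : R) : 0 < e ->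
  exists K, forall j n, (K <= j)%N -> `|a n j| <= e.
Proof.
move=> e0; have e40 : 0 < e / 4 by lra.
have [N [K [c0 hc0]]] := subseries_cylinder e40.
have row n : exists Kn, forall j, (Kn <= j)%N -> `|a n j| <= e / 4.
  have /cvgP/cvg_series_cvg_0/cvgn_distP := @aT n xpredT.
  move=> /(_ _ e40)[Kn hKn]; exists Kn => j /hKn.
  by rewrite mul1r subr0.
have [Kr hKr] := choice row.
exists (maxn K (\max_(n < N.+1) Kr n)) => j n; rewrite geq_max => /andP[Kj Krj].
have small m : (m <= N)%N -> `|a m j| <= e / 4.
  move=> mN; apply: hKr; apply: leq_trans Krj.
  by apply: (@leq_bigmax _ (fun i : 'I_N.+1 => Kr i) (Ordinal (mN : (m < N.+1)%N))).
have [nN|/ltnW Nn] := leqP n N; first by apply: (le_trans (small _ nN)); lra.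
(* c and c' agree with c0 below K and differ only at j *)
pose c i := (i < K)%N && c0 i; pose c' i := (i == j) || c i.
have jump m : T m c' - T m c = a m j.
  have cvB : series (fun i => (c' i)%:R * a m i) \-
      series (fun i => (c i)%:R * a m i) @ \oo --> T m c' - T m c.
    by apply: cvgB; exact: aT.
  suff : series (fun i => (c' i)%:R * a m i) \-
      series (fun i => (c i)%:R * a m i) @ \oo --> a m j.
    by move=> /(cvg_unique _ cvB); apply.
  apply/cvgn_distP => d d0; exists j.+1 => M jM.
  rewrite (_ : (_ \- _) M = a m j) ?subrr ?normr0 ?ltW//.
  rewrite /= /series/= -sumrB; rewrite (bigD1_seq j) ?mem_index_iota ?iota_uniq//=.
  rewrite /c' /c eqxx ltnNge Kj/= mul1r mul0r subr0 big1 ?addr0// => i /negPf ij.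
  by rewrite ij subrr.
have c'c0 i : (i < K)%N -> c' i = c0 i.
  by rewrite /c' /c => iK; rewrite iK; have [ij|//] := eqVneq i j; move: iK; rewrite ij ltnNge Kj.
have cc0 i : (i < K)%N -> c i = c0 i by rewrite /c => ->.
have := hc0 _ c'c0 n N Nn (leqnn _); have := hc0 _ cc0 n N Nn (leqnn _).
have := jump n; have := jump N; have := small N (leqnn _).
by rewrite !ler_norml; lra.
Qed.

End subseries.
End real_sequences.

(** * The space of bounded uniformly continuous functions *)

Section bounded_uniformly_continuous.
Context {R : realType} {S : completeMetricType R}.
Implicit Types (f g : S -> R).

Lemma UbP f : Ub S f <->
  (exists B, forall x, `|f x| <= B) /\
  (forall e, 0 < e -> exists2 d, 0 < d &
     forall x y, mdist x y < d -> `|f x - f y| <= e).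
Proof.
split=> -[bf uf]; split.
- by have [B _ fB] := pinfty_ex_gt0 bf; exists B => x; exact: fB.
- move=> e e0; have /unif_continuousP/(_ _ e0)[d d0 fd] := uf.
  exists d => // x y xyd; apply/ltW; apply: (fd (x, y)).
  by rewrite ballEmdist.
- have [B fB] := bf; exists B; split; first exact: num_real.
  by move=> M BM x _; apply: le_trans (fB x) (ltW BM).
- apply/unif_continuousP => e e0.
  have [|d d0 fd] := uf (e / 2); first by lra.
  exists d => // -[x y]; rewrite ballEmdist/= => /fd fxy.
  by apply: le_lt_trans fxy _; lra.
Qed.

Lemma Ub_cst c : Ub S (fun=> c).
Proof.
apply/UbP; split; first by exists `|c|.
by move=> e e0; exists 1 => // x y _; rewrite subrr normr0 ltW.
Qed.

Lemma Ub_lin (a : R) f g : Ub S f -> Ub S g -> Ub S (fun x => a * f x + g x).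
Proof.
move=> /UbP[[A fA] uf] /UbP[[B gB] ug]; apply/UbP; split.
  exists (`|a| * A + B) => x; apply: (le_trans (ler_normD _ _)).
  by rewrite normrM lerD// ler_wpM2l.
move=> e e0; have a0 : 0 < `|a| + 1 by rewrite ltr_wpDl.
have [|d1 d10 h1] := uf (e / 2 / (`|a| + 1)); first by rewrite !divr_gt0.
have [|d2 d20 h2] := ug (e / 2); first by rewrite !divr_gt0.
exists (Num.min d1 d2) => [|x y]; first by rewrite lt_min d10.
rewrite lt_min => /andP[/h1 f1 /h2 g1].
rewrite (_ : _ - _ = a * (f x - f y) + (g x - g y)); last by ring.
apply: (le_trans (ler_normD _ _)).
rewrite [leRHS](_ : _ = e / 2 + e / 2) ?lerD//; last by field.
rewrite normrM (@le_trans _ _ ((`|a| + 1) * `|f x - f y|))//.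
  by rewrite ler_wpM2r// lerDl.
by move: f1; rewrite ler_pdivlMr// mulrC.
Qed.

Lemma UbD f g : Ub S f -> Ub S g -> Ub S (fun x => f x + g x).
Proof.
by move=> uf ug; have := Ub_lin 1 uf ug; under eq_fun do rewrite mul1r.
Qed.

Lemma UbZ (a : R) f : Ub S f -> Ub S (fun x => a * f x).
Proof.
by move=> uf; have := Ub_lin a uf (Ub_cst 0); under eq_fun do rewrite addr0.
Qed.

Lemma UbB f g : Ub S f -> Ub S g -> Ub S (fun x => f x - g x).
Proof.
move=> uf ug; have := Ub_lin (-1) ug uf.
by under eq_fun do rewrite mulN1r addrC.
Qed.

Lemma UbM f g : Ub S f -> Ub S g -> Ub S (fun x => f x * g x).
Proof.
move=> /UbP[[A fA] uf] /UbP[[B gB] ug]; apply/UbP.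
have A0 : 0 <= A by apply: le_trans (fA point).
have B0 : 0 <= B by apply: le_trans (gB point).
split.
  by exists (A * B) => x; rewrite normrM ler_pM.
move=> e e0; have A1 : 0 < A + 1 by rewrite ltr_wpDl.
have B1 : 0 < B + 1 by rewrite ltr_wpDl.
have [|d1 d10 h1] := uf (e / 2 / (B + 1)); first by rewrite !divr_gt0.
have [|d2 d20 h2] := ug (e / 2 / (A + 1)); first by rewrite !divr_gt0.
exists (Num.min d1 d2) => [|x y]; first by rewrite lt_min d10.
rewrite lt_min => /andP[/h1 f1 /h2 g1].
move: f1 g1; rewrite ler_pdivlMr// => f1; rewrite ler_pdivlMr// => g1.
rewrite (_ : _ - _ = (f x - f y) * g x + f y * (g x - g y)); last by ring.
apply: (le_trans (ler_normD _ _)); rewrite !normrM.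
rewrite [leRHS](_ : _ = e / 2 + e / 2); last by field.
apply: lerD.
  apply: le_trans f1; rewrite ler_wpM2l//; have := gB x; lra.
apply: le_trans g1; rewrite mulrC ler_wpM2l//; have := fA y; lra.
Qed.

Lemma Ub_sum (f_ : nat -> S -> R) N : (forall k, Ub S (f_ k)) ->
  Ub S (fun x => \sum_(0 <= k < N) f_ k x).
Proof.
move=> uf; elim: N => [|N IH].
  by under eq_fun do rewrite big_geq//; exact: Ub_cst.
by under eq_fun do rewrite big_nat_recr//=; exact: UbD.
Qed.

Lemma Ub_uniform_limit (f_ : nat -> S -> R) f : (forall k, Ub S (f_ k)) ->
  (forall e, 0 < e -> exists k, forall x, `|f x - f_ k x| <= e) -> Ub S f.
Proof.
move=> uf ff; apply/UbP; split.
  have [k fk] := ff _ ltr01; have /UbP[[B fB] _] := uf k.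
  exists (1 + B) => x; have := ler_normD (f x - f_ k x) (f_ k x).
  by rewrite subrK => /le_trans; apply; rewrite lerD.
move=> e e0; have e30 : 0 < e / 3 by lra.
have [k fk] := ff _ e30; have /UbP[_ /(_ _ e30)[d d0 hd]] := uf k.
exists d => // x y /hd.
by have := fk x; have := fk y; rewrite !ler_norml; lra.
Qed.

End bounded_uniformly_continuous.

(** * Limits of smooth functionals: gliding humps *)

Section functionals.
Context {R : realType} {S : completeMetricType R}.
Implicit Types (l L : (S -> R) -> R) (f g : S -> R).

Definition linear_Ub l := forall a f g, Ub S f -> Ub S g ->
  l (fun x => a * f x + g x) = a * l f + l g.

(** The form of dominated convergence enjoyed by integration against a signed
    measure; it is the only analytic input about the given measures. *)
Definition smooth_Ub l := forall (f_ : nat -> S -> R) f B,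
  (forall k, Ub S (f_ k)) -> Ub S f -> (forall k x, `|f_ k x| <= B) ->
  (forall x, f_ k x @[k --> \oo] --> f x) -> l (f_ k) @[k --> \oo] --> l f.

Section linear.
Variable l : (S -> R) -> R.
Hypothesis linl : linear_Ub l.

Lemma linear_Ub0 : l (fun=> 0) = 0.
Proof.
have := linl 1 (@Ub_cst R S 0) (@Ub_cst R S 0).
by under eq_fun do rewrite mulr0 addr0; lra.
Qed.

Lemma linear_UbZ a f : Ub S f -> l (fun x => a * f x) = a * l f.
Proof.
move=> uf; have := linl a uf (@Ub_cst R S 0).
by under eq_fun do rewrite addr0; rewrite linear_Ub0 addr0.
Qed.

Lemma linear_UbD f g : Ub S f -> Ub S g -> l (fun x => f x + g x) = l f + l g.
Proof.
move=> uf ug; have := linl 1 uf ug.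
by under eq_fun do rewrite mul1r; rewrite mul1r.
Qed.

Lemma linear_UbB f g : Ub S f -> Ub S g -> l (fun x => f x - g x) = l f - l g.
Proof.
move=> uf ug; have := linl (-1) ug uf.
by under eq_fun do rewrite mulN1r addrC; rewrite mulN1r addrC.
Qed.

Lemma linear_Ub_sum (f_ : nat -> S -> R) N : (forall k, Ub S (f_ k)) ->
  l (fun x => \sum_(0 <= k < N) f_ k x) = \sum_(0 <= k < N) l (f_ k).
Proof.
move=> uf; elim: N => [|N IH].
  by under eq_fun do rewrite big_geq//; rewrite big_geq// linear_Ub0.
under eq_fun do rewrite big_nat_recr//=.
by rewrite linear_UbD//; [rewrite big_nat_recr//= IH|exact: Ub_sum].
Qed.

End linear.

Section limit.
Variables (l : nat -> (S -> R) -> R) (L : (S -> R) -> R).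
Hypothesis linl : forall n, linear_Ub (l n).
Hypothesis smoothl : forall n, smooth_Ub (l n).
Hypothesis lL : forall f, Ub S f -> l n f @[n --> \oo] --> L f.

Lemma linear_Ub_limit : linear_Ub L.
Proof.
move=> a f g uf ug.
have h : l n (fun x => a * f x + g x) @[n --> \oo] --> a * L f + L g.
  under eq_fun do rewrite linl//.
  by apply: cvgD; [apply: cvgM; [exact: cvg_cst|exact: lL]|exact: lL].
by have := cvg_unique _ (lL (Ub_lin a uf ug)) h; apply.
Qed.

(** In this section every sub-sum of the functions h j is again a bounded
    uniformly continuous function H c, so that the matrix of the l n (h j)
    satisfies the hypotheses of [subseries_uniformly_vanishing]. *)
Section hump.
Variables (h : nat -> S -> R) (H : (nat -> bool) -> S -> R) (B : R).
Hypothesis Ubh : forall j, Ub S (h j).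
Hypothesis UbH : forall c, Ub S (H c).
Hypothesis hB : forall (c : nat -> bool) N x,
  `|series (fun j => (c j)%:R * h j x) N| <= B.
Hypothesis hH : forall (c : nat -> bool) x,
  series (fun j => (c j)%:R * h j x) @ \oo --> H c x.

Lemma hump_uniformly_vanishing e : 0 < e ->
  exists K, forall j n, (K <= j)%N -> `|l n (h j)| <= e.
Proof.
apply: (@subseries_uniformly_vanishing _ _ (fun n c => l n (H c))).
  move=> n c.
  have uc j : Ub S (fun x => (c j)%:R * h j x) by exact: UbZ.
  have -> : series (fun j => (c j)%:R * l n (h j)) =
      (fun N => l n (fun x => series (fun j => (c j)%:R * h j x) N)).
    apply/funext => N; rewrite /series/= linear_Ub_sum//.
    by apply: eq_bigr => j _; rewrite linear_UbZ.
  by apply: (@smoothl n _ _ B) => // N; exact: Ub_sum.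
by move=> c; apply: cvgP; exact: lL.
Qed.

Lemma hump_limit_vanishing e : 0 < e ->
  exists K, forall j, (K <= j)%N -> `|L (h j)| <= e.
Proof.
move=> /hump_uniformly_vanishing[K hK]; exists K => j Kj.
by apply: (cvgn_norm_le (lL (Ubh j))) => n; exact: hK.
Qed.

End hump.

(** When supports are disjoint, at most two terms of a sub-sum contribute to its
    oscillation between two given points: sub-sums inherit the common modulus
    of continuity, up to a factor 2. *)
Lemma disjoint_uniformly_vanishing (h : nat -> S -> R) B :
  (forall j x, `|h j x| <= B) ->
  (forall e, 0 < e -> exists2 d, 0 < d &
     forall j x y, mdist x y < d -> `|h j x - h j y| <= e) ->
  (forall x i j, h i x != 0 -> h j x != 0 -> i = j) ->
  forall e, 0 < e -> exists K, forall j n, (K <= j)%N -> `|l n (h j)| <= e.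
Proof.
move=> hB uh dh.
have B0 : 0 <= B by apply: le_trans (hB 0%N point).
have /choice[p hp] : forall x, exists i, forall j, j != i -> h j x = 0.
  move=> x; have [[i ix]|none] := pselect (exists i, h i x != 0).
    by exists i => j; apply: contraNeq => jx; apply/eqP; exact: (dh x).
  exists 0%N => j _; apply/eqP; apply: contrapT => jx; apply: none.
  by exists j; apply/negP.
have part (c : nat -> bool) x N : series (fun j => (c j)%:R * h j x) N =
    (p x < N)%:R * ((c (p x))%:R * h (p x) x).
  elim: N => [|N IH]; first by rewrite series0 mul0r.
  rewrite seriesSr IH ltnS; case: (ltngtP (p x) N) => [pN|Np|<-].
  - by rewrite (hp x N) ?gtn_eqF// mulr0 ?addr0 ?add0r.
  - by rewrite (hp x N) ?ltn_eqF// mulr0 addr0.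
  - by rewrite mul0r add0r mul1r.
have cB (c : nat -> bool) x : `|(c (p x))%:R * h (p x) x| <= B.
  by case: (c _); rewrite ?mul1r// mul0r normr0.
apply: (@hump_uniformly_vanishing h
  (fun c x => (c (p x))%:R * h (p x) x) B).
- move=> j; apply/UbP; split; first by exists B.
  by move=> e /uh[d d0 hd]; exists d => // x y; exact: hd.
- move=> c; apply/UbP; split; first by exists B => x.
  move=> e e0; have [|d d0 hd] := uh (e / 2); first by lra.
  exists d => // x y xy.
  have [<-|pxy] := eqVneq (p x) (p y).
    case: (c _); last by rewrite !mul0r subrr normr0 ltW.
    by rewrite !mul1r; apply: le_trans (hd _ _ _ xy) _; lra.
  have := hd (p x) _ _ xy; have := hd (p y) _ _ xy.
  rewrite (hp _ _ pxy) ; rewrite eq_sym in pxy; rewrite (hp _ _ pxy).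
  by case: (c _); case: (c _); rewrite !(mul1r, mul0r) !ler_norml; lra.
- move=> c N x; rewrite part; case: (_ < _)%N; rewrite ?mul1r//.
  by rewrite mul0r normr0.
- move=> c x; apply/cvgn_distP => e e0; exists (p x).+1 => N pN.
  by rewrite part pN mul1r subrr normr0 ltW.
Qed.

(** A Banach-Steinhaus theorem: functions f j of norm at most 1 with
    |L (f j)| > 2^j would make the humps f j / 2^j, whose sub-sums converge
    uniformly, contradict [hump_limit_vanishing]. *)
Lemma limit_bounded : exists C : R, forall g, Ub S g -> (forall x, `|g x| <= 1) ->
  `|L g| <= C.
Proof.
apply: contrapT => noC.
have /choice[f hf] : forall j, exists f : S -> R,
    [/\ Ub S f, (forall x, `|f x| <= 1) & 2 ^+ j < `|L f| ].
  move=> j; apply: contrapT => no; apply: noC; exists (2 ^+ j) => g ug g1.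
  by rewrite leNgt; apply/negP => Lg; apply: no; exists g.
pose h j x := 2^-1 ^+ j * f j x.
have i0 j : 0 < 2^-1 ^+ j :> R by rewrite exprn_gt0.
have tail (c : nat -> bool) x N M : (N <= M)%N ->
    `|series (fun j => (c j)%:R * h j x) M - series (fun j => (c j)%:R * h j x) N|
      <= 2 * 2^-1 ^+ N - 2 * 2^-1 ^+ M.
  elim: M => [|M IH].
    by rewrite leqn0 => /eqP ->; rewrite !subrr normr0.
  rewrite leq_eqVlt => /predU1P[->|NM]; first by rewrite !subrr normr0.
  rewrite seriesSr addrAC; apply: (le_trans (ler_normD _ _)).
  have : `|(c M)%:R * h M x| <= 2^-1 ^+ M.
    case: (c M); last by rewrite mul0r normr0 ltW.
    rewrite mul1r /h normrM gtr0_norm// ler_piMr ?(ltW (i0 _))//.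
    by have [] := hf M.
  by have := IH NM; rewrite exprS; lra.
have /choice[H hH] : forall c : nat -> bool, exists Hc : S -> R, forall x,
    series (fun j => (c j)%:R * h j x) @ \oo --> Hc x.
  move=> c.
  suff cv x : exists y : R, series (fun j => (c j)%:R * h j x) @ \oo --> y.
    by have [Hc hHc] := choice cv; exists Hc.
  apply/cvg_ex/normed_cvg.
  apply: (@series_le_cvg _ _ (geometric 1 2^-1)) => //=.
  - move=> n; rewrite mul1r; case: (c n); last by rewrite mul0r normr0 ltW.
    rewrite mul1r /h normrM gtr0_norm// ler_piMr ?(ltW (i0 _))//.
    by have [] := hf n.
  - by apply: is_cvg_geometric_series; rewrite ger0_norm// invf_lt1// ltr1n.
have Ubh j : Ub S (h j) by apply: UbZ; have [] := hf j.
have close (c : nat -> bool) x N :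
    `|H c x - series (fun j => (c j)%:R * h j x) N| <= 2 * 2^-1 ^+ N.
  apply: (@cvgn_norm_le _ (fun M => series (fun j => (c j)%:R * h j x) (M + N)%N
     - series (fun j => (c j)%:R * h j x) N)).
    apply: cvgB; last exact: cvg_cst.
    by rewrite (cvg_shiftn N (series (fun j => (c j)%:R * h j x))).
  move=> M; apply: (le_trans (tail c x _ _ (leq_addl _ _))).
  by have := i0 (M + N)%N; lra.
have [|||||K hK] := @hump_limit_vanishing h H 2 _ _ _ _ 1.
- by [].
- move=> c; apply: (@Ub_uniform_limit _ _ (fun N x => series (fun j => (c j)%:R * h j x) N)).
    by move=> N; apply: Ub_sum => j; exact: UbZ.
  move=> e e0.
  have /cvgn_distP/(_ e e0)[N hN] : geometric (2 : R) 2^-1 @ \oo --> (0 : R).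
    by apply: cvg_geometric; rewrite ger0_norm// invf_lt1// ltr1n.
  exists N => x; apply: (le_trans (close _ _ _)).
  by have := hN N (leqnn _); rewrite subr0 /=; apply: le_trans; exact: ler_norm.
- move=> c N x; have := tail c x _ _ (leq0n N).
  by rewrite series0 subr0 expr0 => /le_trans; apply; have := i0 N; lra.
- by [].
- by [].
have := hK K (leqnn _); have [Uf _ KL] := hf K.
rewrite /h (linear_UbZ linear_Ub_limit)// normrM gtr0_norm// leNgt exprVn.
by rewrite ltr_pdivlMl ?exprn_gt0// mulr1 KL.
Qed.

End limit.
End functionals.

(** * A partition of unity along which the limit functional is additive *)

Section lipschitz.
Context {R : realType}.

Lemma dist_min (a b c d k : R) : `|a - c| <= k -> `|b - d| <= k ->
  `|Num.min a b - Num.min c d| <= k.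
Proof. by rewrite !ler_norml; case: (leP a b); case: (leP c d); lra. Qed.

Lemma dist_max0 (a c k : R) : `|a - c| <= k ->
  `|Num.max 0 a - Num.max 0 c| <= k.
Proof. by rewrite !ler_norml; case: (leP 0 a); case: (leP 0 c); lra. Qed.

End lipschitz.

Section partition_of_unity.
Context {R : realType} {S : completeMetricType R}.
Variable q : nat -> S.

(** The distance to the first N points of the sequence q, in units of r and
    capped at 1. *)
Fixpoint gap (r : R) N (x : S) : R :=
  if N is M.+1 then Num.min (gap r M x) (mdist x (q M) / r) else 1.

(** far_bump is supported where gap > 1/2 and near_bump where gap < 1/2. As gap
    decreases with N, a near_bump of some rank and a far_bump of a larger rank
    have disjoint supports. *)
Definition far_bump r N x := Num.max 0 (2 * gap r N x - 1).

Definition near_bump r N x := Num.max 0 (1 - 2 * gap r N x).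

(** The decrease of far_bump when the i-th point is taken into account; it can
    be nonzero only in the ball of radius r around that point. *)
Definition piece r i x := far_bump r i x - far_bump r i.+1 x.

Lemma dist_mdist (x y z : S) : `|mdist x z - mdist y z| <= mdist x y.
Proof.
have := metric_triangle x y z; have := metric_triangle y x z.
by rewrite (metric_sym y x) ler_norml; lra.
Qed.

Section radius.
Variable r : R.
Hypothesis r0 : 0 < r.

Lemma gap_ge0 N x : 0 <= gap r N x.
Proof.
by elim: N => //= N IH; rewrite le_min IH divr_ge0 ?mdist_ge0// ltW.
Qed.

Lemma gap_nonincr N M x : (N <= M)%N -> gap r M x <= gap r N x.
Proof.
elim: M => [|M IH]; first by rewrite leqn0 => /eqP ->.
rewrite leq_eqVlt => /predU1P[->//|NM] /=.
by rewrite ge_min IH.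
Qed.

Lemma gap_le1 N x : gap r N x <= 1.
Proof. exact: (gap_nonincr x (leq0n N)). Qed.

Lemma gap_lip N x y : `|gap r N x - gap r N y| <= mdist x y / r.
Proof.
elim: N => /= [|N IH]; first by rewrite subrr normr0 divr_ge0 ?mdist_ge0 ?ltW.
apply: dist_min => //; rewrite -mulrBl normrM [`|r^-1|]gtr0_norm ?invr_gt0//.
by rewrite ler_pM2r ?invr_gt0// dist_mdist.
Qed.

Lemma far_bump_ge0 N x : 0 <= far_bump r N x. Proof. by rewrite le_max lexx. Qed.

Lemma near_bump_ge0 N x : 0 <= near_bump r N x. Proof. by rewrite le_max lexx. Qed.

Lemma far_bump_le1 N x : far_bump r N x <= 1.
Proof. by rewrite ge_max ler01; have := gap_le1 N x; lra. Qed.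

Lemma near_bump_le1 N x : near_bump r N x <= 1.
Proof. by rewrite ge_max ler01; have := gap_ge0 N x; lra. Qed.

Lemma far_bump_at0 x : far_bump r 0 x = 1.
Proof. by rewrite /far_bump /= max_r; lra. Qed.

Lemma far_bump_lip N x y : `|far_bump r N x - far_bump r N y| <= 2 / r * mdist x y.
Proof.
apply: dist_max0; have := gap_lip N x y; rewrite !ler_norml.
by rewrite (_ : 2 / r * _ = 2 * (mdist x y / r)); [lra|ring].
Qed.

Lemma near_bump_lip N x y : `|near_bump r N x - near_bump r N y| <= 2 / r * mdist x y.
Proof.
apply: dist_max0; have := gap_lip N x y; rewrite !ler_norml.
by rewrite (_ : 2 / r * _ = 2 * (mdist x y / r)); [lra|ring].
Qed.

Lemma Ub_lipschitz (p : S -> R) K : (forall x, 0 <= p x) -> (forall x, p x <= 1) ->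
  (forall x y, `|p x - p y| <= K * mdist x y) -> Ub S p.
Proof.
move=> p0 p1 pK; apply/UbP; split; first by exists 1 => x; rewrite ger0_norm.
move=> e e0; have K1 : 0 < `|K| + 1 by rewrite ltr_wpDl.
exists (e / (`|K| + 1)); first by rewrite divr_gt0.
move=> x y; rewrite ltr_pdivlMr// => xy; apply: (le_trans (pK x y)).
have := mdist_ge0 x y; have := ler_norm K; nra.
Qed.

Lemma Ub_far_bump N : Ub S (far_bump r N).
Proof. exact: (Ub_lipschitz (far_bump_ge0 N) (far_bump_le1 N) (far_bump_lip N)). Qed.

Lemma Ub_near_bump N : Ub S (near_bump r N).
Proof. exact: (Ub_lipschitz (near_bump_ge0 N) (near_bump_le1 N) (near_bump_lip N)). Qed.

Lemma Ub_piece i : Ub S (piece r i).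
Proof. by apply: UbB; exact: Ub_far_bump. Qed.

Lemma far_bump_nonincr N M x : (N <= M)%N -> far_bump r M x <= far_bump r N x.
Proof.
move=> NM; rewrite ge_max far_bump_ge0/= /far_bump le_max.
by have := gap_nonincr x NM; rewrite orbC; have [] := leP 0 (2 * gap r N x - 1); lra.
Qed.

Lemma piece_ge0 i x : 0 <= piece r i x.
Proof. by rewrite subr_ge0 far_bump_nonincr. Qed.

Lemma piece_le1 i x : piece r i x <= 1.
Proof. by have := far_bump_le1 i x; have := far_bump_ge0 i.+1 x; rewrite /piece; lra. Qed.

Lemma piece_support i x : piece r i x != 0 -> mdist x (q i) < r.
Proof.
apply: contraNT; rewrite -leNgt => rx; rewrite /piece /far_bump /= min_l ?subrr//.
by apply: (le_trans (gap_le1 _ _)); rewrite ler_pdivlMr// mul1r.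
Qed.

Lemma sum_piece N x : \sum_(0 <= i < N) piece r i x = 1 - far_bump r N x.
Proof.
elim: N => [|N IH]; first by rewrite big_geq// far_bump_at0 subrr.
by rewrite big_nat_recr//= IH /piece; ring.
Qed.

Hypothesis qdense : forall (x : S) (e : R), 0 < e -> exists n, mdist x (q n) < e.

Lemma gap_small x (e : R) : 0 < e ->
  exists N, forall M, (N <= M)%N -> gap r M x < e.
Proof.
move=> e0; have [|n xn] := @qdense x (e * r); first by rewrite mulr_gt0.
exists n.+1 => M nM; apply: le_lt_trans (gap_nonincr x nM) _.
by rewrite /= gt_min ltr_pdivrMr// xn orbT.
Qed.

Lemma near_bump_cvg x : near_bump r N x @[N --> \oo] --> (1 : R).
Proof.
apply/cvgn_distP => e e0.
have [|N hN] := @gap_small x (Num.min (1 / 2) (e / 2)); first by rewrite lt_min; lra.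
exists N => M /hN; rewrite lt_min => /andP[g1 g2]; have := gap_ge0 M x.
by rewrite /near_bump max_r ?ler_norml; lra.
Qed.

Variables (l : nat -> (S -> R) -> R) (L : (S -> R) -> R).
Hypothesis linl : forall n, linear_Ub (l n).
Hypothesis smoothl : forall n, smooth_Ub (l n).
Hypothesis lL : forall f, Ub S f -> l n f @[n --> \oo] --> L f.

(** The functions f * far_bump N tend to 0 pointwise and are equicontinuous, but
    L is only a limit of smooth functionals. If L did not tend to 0 along them,
    smoothness of a single l n would allow to cut f * far_bump N by a
    near_bump of much larger rank and keep a value of l n larger than e / 2.
    Iterating yields infinitely many such humps with disjoint supports, against
    [disjoint_uniformly_vanishing]. The sums of arbitrary sub-families of
    pieces need not be uniformly continuous, whence the detour through disjoint
    supports. *)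
Lemma limit_far_bump_vanishing f : Ub S f ->
  L (fun x => f x * far_bump r N x) @[N --> \oo] --> (0 : R).
Proof.
move=> uf; have [[B fB] uf'] := (UbP f).1 uf.
have B0 : 0 <= B by apply: le_trans (fB point).
apply/cvgn_distP => e e0; apply: contrapT => /forallNP none.
have Uw N : Ub S (fun x => f x * far_bump r N x) by apply: UbM => //; exact: Ub_far_bump.
have step N0 : exists t : nat * nat * nat, [/\ (N0 <= t.1.1)%N, (t.1.1 <= t.1.2)%N &
    e / 2 < `|l t.2 (fun x => f x * far_bump r t.1.1 x * near_bump r t.1.2 x)|].
  have /existsNP[N /not_implyP[N0N /negP]] := none N0.
  rewrite subr0 -ltNge => eN.
  have [n en] : exists n, e < `|l n (fun x => f x * far_bump r N x)|.
    apply: contrapT => /forallNP no; move: eN; rewrite ltNge => /negP; apply.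
    by apply: (cvgn_norm_le (lL (Uw N))) => n; rewrite leNgt; apply/negP/no.
  have : l n (fun x => f x * far_bump r N x * near_bump r M x) @[M --> \oo] -->
         l n (fun x => f x * far_bump r N x).
    apply: (@smoothl n _ _ B) => //.
    - by move=> k; apply: UbM => //; exact: Ub_near_bump.
    - move=> k x; rewrite !normrM (ger0_norm (far_bump_ge0 _ _)) (ger0_norm (near_bump_ge0 _ _)).
      rewrite -mulrA; apply: le_trans (fB x); rewrite ler_piMr// mulr_ile1//.
      + exact: far_bump_ge0.
      + exact: near_bump_ge0.
      + exact: far_bump_le1.
      + exact: near_bump_le1.
    - move=> x; rewrite -[X in _ --> X]mulr1; apply: cvgM; first exact: cvg_cst.
      exact: near_bump_cvg.
  move=> /cvgn_distP /(_ (e / 2)); rewrite divr_gt0// => /(_ isT)[M hM].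
  exists (N, maxn N M, n); rewrite /= leq_maxl; split => //.
  have := hM _ (leq_maxr N M).
  have := lerB_dist (l n (fun x => f x * far_bump r N x))
    (l n (fun x => f x * far_bump r N x * near_bump r (maxn N M) x)).
  by rewrite distrC; lra.
have [st hst] := choice step.
(* each hump starts at the rank where the previous one was cut *)
pose T := fix T k := if k is k'.+1 then (st (T k')).1.2 else 0%N.
have T_le i j : (i <= j)%N -> (T i <= T j)%N.
  elim: j => [|j IH]; first by rewrite leqn0 => /eqP ->.
  rewrite leq_eqVlt => /predU1P[->//|ij]; apply: leq_trans (IH ij) _ => /=.
  by have [a b _] := hst (T j); exact: leq_trans a b.
pose h k x := f x * far_bump r (st (T k)).1.1 x * near_bump r (st (T k)).1.2 x.
have hsupp k x : h k x != 0 -> gap r (T k.+1) x < 2^-1 /\ 2^-1 < gap r (st (T k)).1.1 x.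
  rewrite /h !mulf_eq0 !negb_or => /andP[/andP[_ t0] h0]; split; rewrite ltNge.
    by apply: contra h0 => ?; rewrite /near_bump max_l//; lra.
  by apply: contra t0 => ?; rewrite /far_bump max_l//; lra.
have dis x i j : (i < j)%N -> h i x != 0 -> h j x != 0 -> False.
  move=> ij /hsupp[+ _] /hsupp[_]; have [Tj _ _] := hst (T j).
  by have := gap_nonincr x (leq_trans (T_le _ _ ij) Tj); lra.
have [||||K hK] := @disjoint_uniformly_vanishing _ _ _ _ linl smoothl lL h B _ _ _ (e / 2).
- move=> k x.
  rewrite /h !normrM (ger0_norm (far_bump_ge0 _ _)) (ger0_norm (near_bump_ge0 _ _)).
  rewrite -mulrA; apply: le_trans (fB x); rewrite ler_piMr// mulr_ile1//.
  + exact: far_bump_ge0.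
  + exact: near_bump_ge0.
  + exact: far_bump_le1.
  + exact: near_bump_le1.
- move=> d d0; have [|c c0 hc] := uf' (d / 2); first lra.
  pose A := B * (4 / r) + 1.
  have A0 : 0 < A by rewrite ltr_wpDl// mulr_ge0// divr_ge0// ltW.
  exists (Num.min c (d / 2 / A)); first by rewrite lt_min c0 !divr_gt0.
  move=> k x y; rewrite lt_min => /andP[/hc fxy]; rewrite ltr_pdivlMr// => xyd.
  rewrite /h; set N := _.1.1; set M := _.1.2.
  have -> : f x * far_bump r N x * near_bump r M x - f y * far_bump r N y * near_bump r M y =
     (f x - f y) * (far_bump r N x * near_bump r M x) +
     (f y * (far_bump r N x - far_bump r N y) * near_bump r M x +
      f y * (near_bump r M x - near_bump r M y) * far_bump r N y) by ring.
  have t0 z := ger0_norm (far_bump_ge0 N z); have h0 z := ger0_norm (near_bump_ge0 M z).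
  apply: (le_trans (ler_normD _ _)).
  have b1 : `|(f x - f y) * (far_bump r N x * near_bump r M x)| <= d / 2.
    apply: le_trans fxy; rewrite !normrM t0 h0 ler_piMr// mulr_ile1//.
    + exact: far_bump_ge0.
    + exact: near_bump_ge0.
    + exact: far_bump_le1.
    + exact: near_bump_le1.
  have b2 : `|f y * (far_bump r N x - far_bump r N y) * near_bump r M x| <=
      B * (2 / r * mdist x y).
    rewrite normrM h0; apply: (@le_trans _ _ `|f y * (far_bump r N x - far_bump r N y)|).
      by rewrite ler_piMr// near_bump_le1.
    by rewrite normrM ler_pM// far_bump_lip.
  have b3 : `|f y * (near_bump r M x - near_bump r M y) * far_bump r N y| <=
      B * (2 / r * mdist x y).
    rewrite normrM t0; apply: (@le_trans _ _ `|f y * (near_bump r M x - near_bump r M y)|).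
      by rewrite ler_piMr// far_bump_le1.
    by rewrite normrM ler_pM// near_bump_lip.
  have := ler_normD (f y * (far_bump r N x - far_bump r N y) * near_bump r M x)
    (f y * (near_bump r M x - near_bump r M y) * far_bump r N y).
  have xy0 := mdist_ge0 x y.
  suff : B * (2 / r * mdist x y) + B * (2 / r * mdist x y) <= d / 2 by lra.
  by move: xyd; rewrite /A; lra.
- move=> x i j ix jx; case: (ltngtP i j) => // ij.
    by have := dis x _ _ ij ix jx.
  by have := dis x _ _ ij jx ix.
- by rewrite divr_gt0.
have [_ _] := hst (T K); rewrite ltNge => /negP; apply.
exact: hK.
Qed.

Lemma limit_piece_series f : Ub S f ->
  series (fun i => L (fun x => f x * piece r i x)) @ \oo --> L f.
Proof.
move=> uf; have linL := linear_Ub_limit linl lL.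
have -> : series (fun i => L (fun x => f x * piece r i x)) =
    (fun N => L f - L (fun x => f x * far_bump r N x)).
  apply/funext => N; rewrite /series/= -linear_Ub_sum//; last first.
    by move=> k; apply: UbM => //; exact: Ub_piece.
  rewrite -linear_UbB//; last by apply: UbM => //; exact: Ub_far_bump.
  congr L; apply/funext => x; rewrite -mulr_sumr sum_piece; ring.
rewrite -[X in _ --> X]subr0; apply: cvgB; first exact: cvg_cst.
exact: limit_far_bump_vanishing.
Qed.

End radius.
End partition_of_unity.

(** * The total variation of a functional *)

Section total_variation.
Context {R : realType} {S : completeMetricType R}.
Variable (L : (S -> R) -> R) (C : R).
Hypothesis linL : linear_Ub L.
Hypothesis LC : forall g, Ub S g -> (forall x, `|g x| <= 1) -> `|L g| <= C.

(** The value at p of the positive functional usually written |L|. *)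
Definition functional_variation (p : S -> R) : R :=
  sup [set L g | g in [set g | Ub S g /\ forall x, `|g x| <= p x]].

Section props.
Variable p : S -> R.
Hypothesis p0 : forall x, 0 <= p x.

Lemma functional_variation_nonempty :
  [set L g | g in [set g | Ub S g /\ forall x, `|g x| <= p x]] !=set0.
Proof.
exists (L (fun=> 0)), (fun=> 0) => //; split; first exact: Ub_cst.
by move=> x; rewrite normr0.
Qed.

Lemma functional_variation_le (c : R) :
  (forall g, Ub S g -> (forall x, `|g x| <= p x) -> L g <= c) ->
  functional_variation p <= c.
Proof.
move=> h; apply: ge_sup; first exact: functional_variation_nonempty.
by move=> _ [g [ug gp] <-]; exact: h.
Qed.

Hypothesis p1 : forall x, p x <= 1.

Lemma functional_variation_ub g : Ub S g -> (forall x, `|g x| <= p x) ->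
  L g <= functional_variation p.
Proof.
move=> ug gp; apply: ub_le_sup; last by exists g.
exists C => _ [h [uh hp] <-]; apply: le_trans (ler_norm _) _; apply: LC => // x.
exact: le_trans (hp x) (p1 x).
Qed.

Lemma functional_variation_norm g : Ub S g -> (forall x, `|g x| <= p x) ->
  `|L g| <= functional_variation p.
Proof.
move=> ug gp; rewrite ler_norml functional_variation_ub// andbT lerNl.
have <- : L (fun x => -1 * g x) = - L g by rewrite linear_UbZ// mulN1r.
by apply: functional_variation_ub => [|x]; [exact: UbZ|rewrite mulN1r normrN].
Qed.

Lemma functional_variation_ge0 : 0 <= functional_variation p.
Proof.
apply: le_trans (normr_ge0 (L (fun=> 0))) _.
by apply: functional_variation_norm => [|x]; [exact: Ub_cst|rewrite normr0].
Qed.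

End props.

Lemma functional_variation_mono p p' : (forall x, 0 <= p x) -> (forall x, p x <= p' x) ->
  (forall x, p' x <= 1) -> functional_variation p <= functional_variation p'.
Proof.
move=> p0 pp' p'1; apply: functional_variation_le => // g ug gp; apply: functional_variation_ub => // x.
exact: le_trans (gp x) (pp' x).
Qed.

Lemma functional_variation_superadd p p' : (forall x, 0 <= p x) -> (forall x, 0 <= p' x) ->
  (forall x, p x + p' x <= 1) ->
  functional_variation p + functional_variation p' <=
    functional_variation (fun x => p x + p' x).
Proof.
move=> p0 p'0 pp'1; rewrite -lerBrDr; apply: functional_variation_le => // g ug gp.
rewrite lerBrDr -lerBrDl; apply: functional_variation_le => // h uh hp'.
rewrite lerBrDl -linear_UbD//; apply: functional_variation_ub => // [|x]; first exact: UbD.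
by apply: le_trans (ler_normD _ _) _; rewrite lerD.
Qed.

Lemma functional_variation_sum (p_ : nat -> S -> R) N : (forall k x, 0 <= p_ k x) ->
  (forall x, \sum_(0 <= k < N) p_ k x <= 1) ->
  \sum_(0 <= k < N) functional_variation (p_ k) <=
    functional_variation (fun x => \sum_(0 <= k < N) p_ k x).
Proof.
move=> p0; elim: N => [|N IH] p1.
  rewrite big_geq//; apply: functional_variation_ge0 => x; first by rewrite big_geq.
  by rewrite big_geq// ler01.
rewrite big_nat_recr//=.
under [X in _ <= functional_variation X]eq_fun do rewrite big_nat_recr//=.
apply: le_trans (functional_variation_superadd _ _ _) => // [|x|x].
- rewrite lerD2r; apply: IH => x; apply: le_trans (p1 x).
  by rewrite big_nat_recr//= lerDl.
- by apply: sumr_ge0.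
- by apply: le_trans (p1 x); rewrite big_nat_recr.
Qed.

(** |L| is additive along the partition of unity: the partial sums are bounded
    by superadditivity, and conversely any competitor g splits as the sum of
    the g * piece i, each of which competes for p * piece i. *)
Lemma functional_variation_series (q : nat -> S) r p : 0 < r ->
  (forall f, Ub S f ->
    series (fun i => L (fun x => f x * piece q r i x)) @ \oo --> L f) ->
  (forall x, 0 <= p x) -> (forall x, p x <= 1) ->
  series (fun i => functional_variation (fun x => p x * piece q r i x)) @ \oo -->
    functional_variation p.
Proof.
move=> r0 Lser p0 p1.
have pp0 i x : 0 <= p x * piece q r i x by rewrite mulr_ge0// piece_ge0.
have pp1 i x : p x * piece q r i x <= 1 by rewrite mulr_ile1// ?piece_ge0// piece_le1.
have psum N x : \sum_(0 <= k < N) p x * piece q r k x <= p x.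
  rewrite -mulr_sumr sum_piece// ler_piMr//.
  by have := far_bump_ge0 q r N x; lra.
set s := series _.
have s_le N : s N <= functional_variation p.
  apply: le_trans (functional_variation_sum _ _) _ => // [x|].
    exact: le_trans (psum N x) (p1 x).
  by apply: functional_variation_mono => // x; apply: sumr_ge0.
have s_cvg : s @ \oo --> sup (range s).
  apply: nondecreasing_cvgn; last by exists (functional_variation p) => _ [N _ <-].
  by apply: nondecreasing_series => i _ _; exact: functional_variation_ge0.
suff -> : functional_variation p = sup (range s) by [].
apply/eqP; rewrite eq_le; apply/andP; split.
  apply: functional_variation_le => // g ug gp.
  apply: (cvgn_le (Lser g ug) s_cvg) => N.
  rewrite /s /series/=; apply: ler_sum => i _; apply: functional_variation_ub => // [|x].
    by apply: UbM => //; exact: Ub_piece.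
  by rewrite normrM (ger0_norm (piece_ge0 _ _ _ _))// ler_wpM2r// piece_ge0.
by apply: (cvgn_le s_cvg (@cvg_cst _ (functional_variation p) _ _ _)) => N; exact: s_le.
Qed.

End total_variation.

(** * Coding an additive weight on a tree by intervals *)

(** A list of integers is a node of a tree, the most recent choice coming first:
    the children of s are the lists i :: s. A weight which is the sum of its
    values over the children is realised by the lengths of nested intervals. *)
Section cells.
Context {R : realType}.
Variable w : seq nat -> R.
Hypothesis w_ge0 : forall s, 0 <= w s.
Hypothesis w_series : forall s, series (fun i => w (i :: s)) @ \oo --> w s.

Fixpoint left_end (s : seq nat) : R :=
  if s is i :: s' then left_end s' + series (fun j => w (j :: s')) i else 0.

Definition cell s : set (measurableTypeR R) := [set` `[left_end s, left_end s + w s[].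

Lemma cellP s t : cell s t <-> left_end s <= t < left_end s + w s.
Proof. by rewrite /cell /= in_itv. Qed.

Lemma series_w_mono s i j : (i <= j)%N ->
  series (fun i => w (i :: s)) i <= series (fun i => w (i :: s)) j.
Proof.
apply: (nondecreasing_seqP (series (fun i => w (i :: s)))).1 => n.
by rewrite seriesSr lerDl.
Qed.

Lemma series_w_le s N : series (fun i => w (i :: s)) N <= w s.
Proof.
have h : series (fun i => w (i :: s)) (n + N)%N @[n --> \oo] --> w s.
  by rewrite (cvg_shiftn N (series (fun i => w (i :: s)))); exact: w_series.
apply: (cvgn_le (@cvg_cst _ (series (fun i => w (i :: s)) N) _ _ _) h) => n.
exact/series_w_mono/leq_addl.
Qed.

Lemma cell_sub i s : cell (i :: s) `<=` cell s.
Proof.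
move=> t /cellP/andP[/= a b]; apply/cellP/andP; split.
  apply: le_trans a; rewrite lerDl.
  by have := series_w_mono s (leq0n i); rewrite series0.
by apply: (lt_le_trans b); rewrite -addrA lerD2l -seriesSr series_w_le.
Qed.

Lemma cell_cover s t : cell s t -> exists i, cell (i :: s) t.
Proof.
move=> /cellP/andP[st ts].
have ex : exists n, t < left_end s + series (fun i => w (i :: s)) n.
  have /cvgn_distP/(_ ((left_end s + w s - t) / 2)) := @w_series s.
  rewrite divr_gt0 ?subr_gt0// => /(_ isT)[n /(_ n (leqnn n)) sn].
  by exists n; move: ts sn; rewrite ler_norml; lra.
case: (ex_minnP ex) => -[|n]; first by rewrite series0 addr0 ltNge st.
rewrite seriesSr addrA => tn min; exists n; apply/cellP; rewrite /= tn andbT.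
by rewrite leNgt; apply/negP => /min; rewrite ltnn.
Qed.

Lemma cell_inj i j s t : cell (i :: s) t -> cell (j :: s) t -> i = j.
Proof.
wlog ij : i j / (i < j)%N.
  move=> h it jt; case: (ltngtP i j) => // ij; first exact: h.
  by apply/esym/h.
move=> /cellP/=/andP[_ ti] /cellP/=/andP[tj _].
have := series_w_mono s ij; rewrite seriesSr /= => h; exfalso.
have := lt_le_trans ti (le_trans _ tj); rewrite ltxx => /(_ _)/notF; apply.
by rewrite -addrA lerD2l.
Qed.

Lemma cell_unique s s' t : size s = size s' -> cell s t -> cell s' t -> s = s'.
Proof.
elim: s s' => [[]//|i s IH [//|j s']] [ss'] st s't.
have := IH _ ss' (cell_sub st) (cell_sub s't) => e; subst s'.
by rewrite (cell_inj st s't).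
Qed.

Lemma cell_level k t : cell [::] t -> exists2 s, size s = k & cell s t.
Proof.
move=> t0; elim: k => [|k [s sk st]]; first by exists [::].
by have [i it] := cell_cover st; exists (i :: s) => //=; rewrite sk.
Qed.

(** Nodes of weight zero have empty cells, so they are never visited. *)
Lemma cell_w s t : cell s t -> w s != 0.
Proof. by move=> /cellP /andP[a b]; apply/eqP; lra. Qed.

Lemma measurable_cell s : measurable (cell s).
Proof. exact: measurable_itv. Qed.

End cells.

(** * From weights on a tree of small sets to Borel measures *)

Section Ub_integrals.
Context {R : realType} {S : completeMetricType R}.

Lemma Ub_measurable (f : S -> R) : Ub S f ->
  measurable_fun setT (f : borel S -> R).
Proof.
move=> /UbP[_ uf]; apply: (measurability _ (RGenOInfty.measurableE R)).
move=> _ [_ [a ->] <-]; rewrite setTI; apply: sub_sigma_algebra.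
rewrite openE => x /=; rewrite in_itv/= andbT => ax.
have [|d d0 hd] := uf ((f x - a) / 2); first by rewrite divr_gt0// subr_gt0.
apply/nbhs_ballP; exists d => //= y; rewrite ballEmdist/= => /hd.
by rewrite in_itv/= andbT ler_norml; lra.
Qed.

Lemma Ub_integrable (mu : {finite_measure set (borel S) -> \bar R}) (f : S -> R) :
  Ub S f -> mu.-integrable setT (EFin \o f).
Proof.
move=> uf; apply: measurable_bounded_integrable => //.
- by rewrite -ge0_fin_numE//; exact: fin_num_measure.
- exact: Ub_measurable.
- by case: uf.
Qed.

End Ub_integrals.

(** Each node s now also carries a set T s, nonempty as soon as w s is not zero,
    and these sets shrink along every branch. *)
Section coding.
Context {R : realType} {S : completeMetricType R}.
Variables (T : seq nat -> set S) (rho : nat -> R) (w : seq nat -> R).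
Hypothesis T_sub : forall i s, T (i :: s) `<=` T s.
Hypothesis T_diam : forall i s x y, T (i :: s) x -> T (i :: s) y ->
  mdist x y <= rho (size s).
Hypothesis rho_cvg : rho @ \oo --> (0 : R).
Hypothesis w_ge0 : forall s, 0 <= w s.
Hypothesis w_series : forall s, series (fun i => w (i :: s)) @ \oo --> w s.
Hypothesis w_T : forall s, w s != 0 -> T s !=set0.

(** A real t selects a branch b, and points z k of T (b k) form a Cauchy
    sequence: this is where completeness of the space enters. *)
Lemma coding_point t : cell w [::] t -> exists y, forall i s,
  cell w (i :: s) t -> forall z, T (i :: s) z -> mdist z y <= rho (size s).
Proof.
move=> t0; have lev k := cell_level w_series k t0.
have /choice[b hb] : forall k, exists s, size s = k /\ cell w s t.
  by move=> k; have [s ? ?] := lev k; exists s.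
have bS k : exists i, b k.+1 = i :: b k.
  have [sk tk] := hb k; have [] := hb k.+1.
  case: (b k.+1) => // i s [sk1] ts; exists i; congr (_ :: _).
  by apply: (cell_unique w_ge0 w_series _ (cell_sub w_ge0 w_series ts) tk); rewrite sk1.
have bT k m : (k <= m)%N -> T (b m) `<=` T (b k).
  elim: m => [|m IH]; first by rewrite leqn0 => /eqP ->.
  rewrite leq_eqVlt => /predU1P[->//|km]; apply: subset_trans (IH km).
  by have [i ->] := bS m.
have /choice[z hz] : forall k, exists z, T (b k) z.
  by move=> k; apply/w_T/(@cell_w _ _ _ t); have [] := hb k.
have near k m : (k < m)%N -> forall x, T (b k.+1) x -> mdist x (z m) <= rho k.
  move=> km x; have [i bi] := bS k; have := hz m => /(bT _ _ km).
  by rewrite bi => zm xT; have := T_diam xT zm; have [-> _] := hb k.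
have zc : cauchy (z @ \oo).
  apply: cauchy_exP => e e0; have e20 : 0 < e / 2 by lra.
  have /cvgn_distP/(_ _ e20)[k /(_ k (leqnn k))] := rho_cvg.
  rewrite subr0 => rk; exists (z k.+1); exists k.+1 => // m /= km.
  rewrite ballEmdist/=; apply: le_lt_trans (near _ _ km _ (hz _)) _.
  by move: rk; rewrite ler_norml; lra.
have /cvg_ex[y zy] : cvg (z @ \oo) by exact: cauchy_cvg.
exists y => i s ist x xT.
have bs : b (size s).+1 = i :: s.
  by have [sb tb] := hb (size s).+1; apply: (cell_unique w_ge0 w_series _ tb ist).
apply/ler_addgt0Pl => e e0.
have /metricType_numDomainType.cvgrPdist_lt/(_ e e0)[N _ hN] := zy.
have := hN (maxn N (size s).+1) (leq_maxl _ _) => /= yz.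
have := near (size s) (maxn N (size s).+1) (leq_maxr _ _) x; rewrite bs => /(_ xT).
have := metric_triangle x (z (maxn N (size s).+1)) y.
by move: yz; rewrite (metric_sym y); lra.
Qed.

Definition code (t : measurableTypeR R) : S :=
  if pselect (cell w [::] t) is left t0 then sval (cid (coding_point t0)) else point.

Lemma codeP i s t : cell w (i :: s) t -> forall z, T (i :: s) z ->
  mdist z (code t) <= rho (size s).
Proof.
move=> ist; rewrite /code; case: pselect => [t0|t0].
  by case: cid => /= y; apply.
exfalso; apply: t0.
have sub u : cell w u t -> cell w [::] t.
  by elim: u => // j u IH /(cell_sub w_ge0 w_series).
exact: sub ist.
Qed.

Lemma code_dist i s t t' : cell w (i :: s) t -> cell w (i :: s) t' ->
  mdist (code t) (code t') <= 2 * rho (size s).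
Proof.
move=> ct ct'; have [z zT] := w_T (cell_w ct).
have := codeP ct zT; have := codeP ct' zT.
by have := metric_triangle (code t) z (code t'); rewrite (metric_sym _ z); lra.
Qed.

(** The preimage of an open set is a countable union of cells, because code
    moves little inside a cell of high level; outside the root cell, code is
    constant. *)
Lemma measurable_code : measurable_fun setT (code : measurableTypeR R -> borel S).
Proof.
apply: (@measurability _ _ _ (borel S) setT code (@open S)) => //.
move=> _ [U oU <-]; rewrite setTI.
pose A := [set s | cell w s `<=` code @^-1` U].
have -> : code @^-1` U = \bigcup_s (if pselect (A s) then cell w s else set0)
    `|` (if pselect (U point) then ~` cell w [::] else set0).
  apply/seteqP; split=> t /=.
    move=> Ut; have [t0|t0] := pselect (cell w [::] t); last first.
      right; case: pselect => // Up; apply: Up.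
      by move: Ut; rewrite /code; case: pselect.
    left; have /nbhs_ballP[e /= e0 eU] : nbhs (code t) U by exact: open_nbhs_nbhs.
    have e30 : 0 < e / 3 by lra.
    have /cvgn_distP/(_ _ e30)[k /(_ k (leqnn k))] := rho_cvg.
    rewrite subr0 ler_norml => /andP[_ rk].
    have [[//|i s] [sk] st] := cell_level w_series k.+1 t0.
    exists (i :: s) => //; case: pselect => // nA; apply: nA => t' st' /=.
    apply: eU; rewrite ballEmdist/=; apply: le_lt_trans (code_dist st st') _.
    by rewrite sk; lra.
  move=> [[s _]|]; first by case: pselect => // As; exact: As.
  by case: pselect => // Up t0; rewrite /code; case: pselect.
apply: measurableU.
  apply: countable_bigcupT_measurable => // s.
  by case: pselect => /= _ //; exact: measurable_cell.
by case: pselect => /= _ //; apply: measurableC; exact: measurable_cell.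
Qed.

Notation lebesgue :=
  (lebesgue_measure : {measure set (measurableTypeR R) -> \bar R}).

Lemma cell_finite : (lebesgue (cell w [::]) < +oo)%E.
Proof. by rewrite /= lebesgue_measure_itv; case: ifP => //= _; rewrite -EFinB ltry. Qed.

Definition restricted_lebesgue :
    {finite_measure set (measurableTypeR R) -> \bar R} :=
  mfrestr (measurable_cell w [::]) cell_finite.

Let image_measure : {measure set (borel S) -> \bar R} :=
  @measure_function_pushforward__canonical__measure_function_Measure
    _ _ _ (borel S) R restricted_lebesgue code measurable_code.

Let code_integral (f : S -> R) a b := \int[lebesgue]_(t in `[a, b[) f (code t).

Let integrable_code f a b : Ub S f ->
  lebesgue.-integrable `[a, b[ (EFin \o (f \o code)).
Proof.
move=> uf; have [[B fB] _] := (UbP f).1 uf.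
apply: measurable_bounded_integrable => //.
- by rewrite /= lebesgue_measure_itv; case: ifP => //= _; rewrite -EFinB ltry.
- apply: measurable_funTS.
  exact: (measurableT_comp (Ub_measurable uf) measurable_code).
- exists B; split; first exact: num_real.
  by move=> M BM t _; exact: le_trans (fB _) (ltW BM).
Qed.

Let code_integral_add f a b c : Ub S f -> a <= b -> b <= c ->
  code_integral f a c = code_integral f a b + code_integral f b c.
Proof.
move=> uf ab bc; rewrite /code_integral (@itv_bndbnd_setU _ _ _ (BLeft b)) ?bnd_simp//.
apply: Rintegral_setU => //.
- by rewrite -itv_bndbnd_setU ?bnd_simp//; exact: integrable_code.
- apply/disj_setPS => t [/=]; rewrite !in_itv/= => /andP[_ tb] /andP[bt _].
  by move: tb; rewrite ltNge bt.
Qed.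

Let code_integral_close f a b c eta : Ub S f -> a <= b ->
  (forall t, a <= t < b -> `|f (code t) - c| <= eta) ->
  `|code_integral f a b - c * (b - a)| <= eta * (b - a).
Proof.
move=> uf ab fc.
have mab : fine (lebesgue `[a, b[%classic) = b - a.
  rewrite /= lebesgue_measure_itv /= lte_fin; move: ab.
  rewrite le_eqVlt => /predU1P[->|->]; first by rewrite ltxx subrr.
  by rewrite -EFinB.
have icst k : lebesgue.-integrable `[a, b[ (EFin \o (fun=> k)).
  by have := integrable_code a b (@Ub_cst R S k).
have -> : c * (b - a) = \int[lebesgue]_(t in `[a, b[) c by rewrite Rintegral_cst// mab.
have -> : eta * (b - a) = \int[lebesgue]_(t in `[a, b[) eta by rewrite Rintegral_cst// mab.
rewrite -RintegralB//; last exact: integrable_code.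
have ib := integrable_code a b (UbB uf (Ub_cst c)).
apply: le_trans (le_normr_Rintegral _ _) _ => //.
by apply: le_Rintegral => //; exact: integrable_norm.
Qed.

(** The image of Lebesgue measure under code. The function J s is the part of the
    integral of f that comes from the branches through s; the last clause says
    that it is f times the weight, up to the oscillation of f near T s. *)
Theorem coded_measure_exists : exists nu : {finite_measure set (borel S) -> \bar R},
  forall f, Ub S f -> exists J : seq nat -> R,
  [/\ J [::] = \int[nu]_x f x,
      forall s, series (fun i => J (i :: s)) @ \oo --> J s &
      forall i s c eta, (forall z y, T (i :: s) z ->
          mdist z y <= rho (size s) -> `|f y - c| <= eta) ->
        `|J (i :: s) - c * w (i :: s)| <= eta * w (i :: s)].
Proof.
have image_finite : (image_measure setT < +oo)%E.
  rewrite -ge0_fin_numE//; apply: (@fin_num_measure _ _ _ restricted_lebesgue).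
  by rewrite preimage_setT.
exists (mfrestr measurableT image_finite) => f uf; have [[B fB] _] := (UbP f).1 uf.
exists (fun s => code_integral f (left_end w s) (left_end w s + w s)); split.
- rewrite /code_integral /Rintegral; congr fine.
  transitivity (\int[image_measure]_(x in [set: borel S]) (f x)%:E)%E; last first.
    apply: eq_measure_integral => A mA _.
    by rewrite /mfrestr /mrestr; congr (image_measure _); rewrite setIT.
  have int : restricted_lebesgue.-integrable setT (EFin \o (f \o code)).
    apply: (measurable_bounded_integrable _ _
      (measurableT_comp (Ub_measurable uf) measurable_code)) => //.
    exists B; split; first exact: num_real.
    by move=> M BM t _; exact: le_trans (fB _) (ltW BM).
  rewrite integral_pushforward//; last 2 first.
  + exact: measurable_code.
  + by apply/measurable_EFinP; exact: Ub_measurable uf.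
  rewrite preimage_setT.
  have mC := measurableC (measurable_cell w [::]).
  rewrite [RHS](negligible_integral mC measurableT int); last first.
    by rewrite /= /mfrestr /mrestr setICl measure0.
  rewrite setTD setCK; apply: eq_measure_integral => A mA AC.
  by congr (lebesgue _); rewrite setIidl.
(* the children of s fill the cell of s from the left, so a partial sum is
     an integral over an initial segment of that cell *)
- move=> s; set c := left_end w s.
  have Ser N : series (fun i => code_integral f (left_end w (i :: s))
        (left_end w (i :: s) + w (i :: s))) N =
      code_integral f c (c + series (fun i => w (i :: s)) N).
    elim: N => [|N IH].
      by rewrite !series0 addr0 /code_integral set_itv_ge ?Rintegral_set0// bnd_simp ltxx.
    rewrite seriesSr IH [series _ N.+1]seriesSr addrA -code_integral_add//; last by rewrite lerDl.
    rewrite lerDl; have := series_w_mono w_ge0 s (leq0n N).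
    by rewrite series0.
  apply/cvgn_distP => e e0.
  have B0 : 0 < B + 1 by rewrite ltr_wpDl//; apply: le_trans (fB point).
  have /cvgn_distP/(_ (e / (B + 1))) := @w_series s.
  rewrite divr_gt0// => /(_ isT)[N hN]; exists N => n /hN.
  rewrite Ser ler_pdivlMr// => wn.
  rewrite (code_integral_add (b := c + series (fun i => w (i :: s)) n) (c := c + w s) uf)//; last 2 first.
  + by rewrite lerDl; have := series_w_mono w_ge0 s (leq0n n); rewrite series0.
  + by rewrite lerD2l series_w_le.
  rewrite opprD addNKr normrN.
  have := @code_integral_close f (c + series (fun i => w (i :: s)) n) (c + w s) 0 B uf.
  rewrite mul0r subr0 lerD2l series_w_le// => /(_ isT) h.
  apply: le_trans (h _) _ => [t _|]; first by rewrite subr0.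
  move: wn; rewrite distrC ger0_norm ?subr_ge0 ?series_w_le//.
  have := series_w_le w_ge0 w_series s n; nra.
- move=> i s c eta fc; set a := left_end w (i :: s).
  have := @code_integral_close f a (a + w (i :: s)) c eta uf.
  have -> : a + w (i :: s) - a = w (i :: s) by rewrite addrAC subrr add0r.
  rewrite lerDl w_ge0 => /(_ isT); apply => t /cellP ct.
  by have [z zT] := w_T (cell_w ct); exact: fc zT (codeP ct zT).
Qed.

End coding.

(** * The pairing with signed measures *)

Section integral_functionals.
Context {R : realType} {S : completeMetricType R}.

Lemma linear_integral (m : {finite_measure set (borel S) -> \bar R}) :
  linear_Ub (fun f : S -> R => \int[m]_x (f x : R)).
Proof.
move=> a f g uf ug; rewrite RintegralD//.
- by rewrite RintegralZl//; exact: Ub_integrable.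
- exact: (Ub_integrable m (UbZ a uf)).
- exact: (Ub_integrable m ug).
Qed.

Lemma smooth_integral (m : {finite_measure set (borel S) -> \bar R}) :
  smooth_Ub (fun f : S -> R => \int[m]_x (f x : R)).
Proof.
move=> f_ f B uf_ uf fB ff; apply: fine_cvg.
rewrite fineK; last by apply: integrable_fin_num => //; exact: (Ub_integrable m uf).
have m_ n : measurable_fun setT (EFin \o (f_ n : borel S -> R)).
  by apply/measurable_EFinP; exact: Ub_measurable.
have mf : measurable_fun setT (EFin \o (f : borel S -> R)).
  by apply/measurable_EFinP; exact: Ub_measurable.
have ff' : {ae m, forall x, setT x -> (EFin \o f_ ^~ x) @ \oo --> (f x)%:E}.
  apply: aeW => x _; apply: cvg_EFin; last exact: ff.
  exact: nearW.
have fB' : {ae m, forall x n, setT x -> (`|(EFin \o f_ n) x| <= (EFin \o cst B) x)%E}.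
  by apply: aeW => x n _ /=; rewrite lee_fin.
by have [] := dominated_convergence measurableT m_ mf ff' (Ub_integrable m (Ub_cst B)) fB'.
Qed.

Lemma linear_pairing (mu : signed_measure S) : linear_Ub (pairing mu).
Proof.
move=> a f g uf ug; rewrite /pairing /charge_integral !linear_integral//; ring.
Qed.

Lemma smooth_pairing (mu : signed_measure S) : smooth_Ub (pairing mu).
Proof.
move=> f_ f B uf_ uf fB ff; apply: cvgB.
  exact: (smooth_integral uf_ uf fB ff).
exact: (smooth_integral uf_ uf fB ff).
Qed.

(** The Jordan decomposition of P - Q need not be (P, Q), but the measures
    P + jn and jp + Q coincide. *)
Lemma pairing_measureB (P Q : {finite_measure set (borel S) -> \bar R}) :
  exists mu : signed_measure S, forall f, Ub S f ->
    pairing mu f = \int[P]_x f x - \int[Q]_x f x.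
Proof.
pose mu : signed_measure S := cadd (charge_of_finite_measure P)
   (cscale (-1) (charge_of_finite_measure Q)).
exists mu => f uf; rewrite /pairing /charge_integral.
set jp := jordan_pos _; set jn := jordan_neg _.
have iP := Ub_integrable P uf; have iQ := Ub_integrable Q uf.
have ip := Ub_integrable jp uf; have in_ := Ub_integrable jn uf.
have mf := (measurable_int _ iP).
suff : \int[P]_x f x + \int[jn]_x f x = \int[jp]_x f x + \int[Q]_x f x by lra.
rewrite /Rintegral -!fineD ?integrable_fin_num// -!integral_measure_add//; congr fine.
apply: eq_measure_integral => A mA _; rewrite /measure_add/= /msum !big_ord_recl !big_ord0/= !adde0.
suff : (P A + jn A = jp A + Q A)%E by [].
have : (P A - Q A = jp A - jn A)%E.
  transitivity (mu A).
    by rewrite /mu/= /cadd/= cscaleN1.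
  by rewrite (jordan_decomp (hahn_posneg mu) mA) /cadd/= cscaleN1.
rewrite -(fineK (fin_num_measure P A mA)) -(fineK (fin_num_measure Q A mA)).
have jpA : jp A \is a fin_num by exact: fin_num_measure.
have jnA : jn A \is a fin_num by exact: fin_num_measure.
rewrite -(fineK jpA) -(fineK jnA).
by rewrite -!EFinB => -[pq]; rewrite -!EFinD; congr EFin; lra.
Qed.

End integral_functionals.

(** * Representation of the limit functional *)

Section tree.
Context {R : realType} {S : completeMetricType R}.
Variable q : nat -> S.

(** Products of pieces of radii 1, 1/2, 1/4, ...: for each k the nodes of length k
    form a partition of unity, refining the previous ones. *)
Fixpoint node (s : seq nat) (x : S) : R :=
  if s is i :: s' then node s' x * piece q (2^-1 ^+ size s') i x else 1.

Lemma radius_gt0 k : 0 < 2^-1 ^+ k :> R. Proof. by rewrite exprn_gt0. Qed.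

Lemma node_ge0 s x : 0 <= node s x.
Proof. by elim: s => //= i s IH; rewrite mulr_ge0// piece_ge0// radius_gt0. Qed.

Lemma node_le1 s x : node s x <= 1.
Proof.
elim: s => //= i s IH; rewrite mulr_ile1 ?node_ge0 ?piece_ge0 ?piece_le1//;
  exact: radius_gt0.
Qed.

Lemma Ub_node s : Ub S (node s).
Proof.
elim: s => [|i s IH]; first exact: Ub_cst.
by apply: UbM => //; exact/Ub_piece/radius_gt0.
Qed.

Definition node_support s : set S := [set x | node s x != 0].

Lemma node_support_sub i s : node_support (i :: s) `<=` node_support s.
Proof. by move=> x /=; rewrite /node_support/= mulf_eq0 negb_or => /andP[]. Qed.

Lemma node_support_diam i s x y : node_support (i :: s) x ->
  node_support (i :: s) y -> mdist x y <= 2 * 2^-1 ^+ size s.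
Proof.
have near z : node_support (i :: s) z -> mdist z (q i) < 2^-1 ^+ size s.
  rewrite /node_support/= mulf_eq0 negb_or => /andP[_].
  exact/piece_support/radius_gt0.
move=> /near xi /near yi; have := metric_triangle x (q i) y.
by rewrite (metric_sym (q i)); lra.
Qed.

End tree.

Section pairing_representation.
Context {R : realType} {S : completeMetricType R}.
Variable q : nat -> S.
Variables (L : (S -> R) -> R) (C : R).
Hypothesis linL : linear_Ub L.
Hypothesis LC : forall g, Ub S g -> (forall x, `|g x| <= 1) -> `|L g| <= C.
Hypothesis L_series : forall r f, 0 < r -> Ub S f ->
  series (fun i => L (fun x => f x * piece q r i x)) @ \oo --> L f.

(** Weights of the two measures whose difference represents L; they correspond
    to |L| and |L| - L. *)
Let v s := functional_variation L (node q s).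
Let v' s := v s - L (node q s).

Let v_norm s g : Ub S g -> (forall x, `|g x| <= node q s x) -> `|L g| <= v s.
Proof. by apply: (functional_variation_norm linL LC) => x; exact: node_le1. Qed.

Let v_node s : `|L (node q s)| <= v s.
Proof.
apply: v_norm => [|x]; first exact: Ub_node.
by rewrite ger0_norm// node_ge0.
Qed.

Let v_ge0 s : 0 <= v s.
Proof. exact: le_trans (normr_ge0 _) (v_node s). Qed.

Let v'_ge0 s : 0 <= v' s.
Proof. by rewrite subr_ge0; apply: le_trans (ler_norm _) (v_node s). Qed.

Let v'_le s : v' s <= 2 * v s.
Proof. by have := v_node s; rewrite ler_norml /v'; lra. Qed.

Let v_series s : series (fun i => v (i :: s)) @ \oo --> v s.
Proof.
apply: (functional_variation_series linL LC (radius_gt0 (size s))).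
- by move=> f; apply: L_series; exact: radius_gt0.
- exact: node_ge0.
- exact: node_le1.
Qed.

Let v'_series s : series (fun i => v' (i :: s)) @ \oo --> v' s.
Proof.
have -> : series (fun i => v' (i :: s)) =
    (fun N => series (fun i => v (i :: s)) N - series (fun i => L (node q (i :: s))) N).
  by apply/funext => N; rewrite /series/= -sumrB.
apply: cvgB; first exact: v_series.
exact: (L_series (radius_gt0 (size s)) (Ub_node q s)).
Qed.

Let v_support s : v s != 0 -> node_support q s !=set0.
Proof.
apply: contra_neqP => none; apply/eqP; rewrite eq_le v_ge0 andbT.
apply: functional_variation_le => [x|g ug gs]; first exact: node_ge0.
suff -> : g = (fun=> 0) by rewrite linear_Ub0.
apply/funext => x; apply/eqP; rewrite -normr_le0; apply: le_trans (gs x) _.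
have [->//|sx] := eqVneq (node q s x) 0.
by exfalso; apply: none; exists x.
Qed.

Let v'_support s : v' s != 0 -> node_support q s !=set0.
Proof.
move=> v's; apply: v_support; apply: contra_neq v's => vs.
by apply/eqP; rewrite eq_le v'_ge0 andbT; have := v'_le s; rewrite vs mulr0.
Qed.

(** Let E s be the error made on f * node s. It is additive along the tree, and
    at level k, where f oscillates by at most eta on each support, it is at most
    4 * eta * v s: once eta * v s for L itself, once for the weight v, and twice
    for v', which is bounded by 2 v. Additivity carries this bound from level k
    up to the root, where v is a fixed number. *)
Theorem pairing_representation : exists mu : signed_measure S,
  forall f, Ub S f -> L f = pairing mu f.
Proof.
pose rho k : R := 2 * 2^-1 ^+ k.
have rho_cvg : rho @ \oo --> (0 : R).
  by apply: cvg_geometric; rewrite ger0_norm// invf_lt1// ltr1n.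
have [P hP]   := coded_measure_exists (@node_support_sub _ _ q) (@node_support_diam _ _ q)
  rho_cvg v_ge0 v_series v_support.
have [Q hQ]   := coded_measure_exists (@node_support_sub _ _ q) (@node_support_diam _ _ q)
  rho_cvg v'_ge0 v'_series v'_support.
have [mu hmu] := pairing_measureB P Q; exists mu => f uf.
have [J [J0 J_series J_close]] := hP f uf.
have [J' [J'0 J'_series J'_close]] := hQ f uf.
rewrite hmu// -J0 -J'0.
pose E s := L (fun x => f x * node q s x) - (J s - J' s).
suff E0 : E [::] = 0.
  by move: E0; rewrite /E /=; under eq_fun do rewrite mulr1; move/subr0_eq.
have E_series s : series (fun i => E (i :: s)) @ \oo --> E s.
  have -> : series (fun i => E (i :: s)) = (fun N =>
      series (fun i => L (fun x => f x * node q s x * piece q (2^-1 ^+ size s) i x)) N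
      - (series (fun i => J (i :: s)) N - series (fun i => J' (i :: s)) N)).
    apply/funext => N; rewrite /series/= -!sumrB; apply: eq_bigr => i _.
    by rewrite /E /=; under eq_fun do rewrite mulrA.
  apply: cvgB; last by apply: cvgB.
  by apply: L_series; [exact: radius_gt0|apply: UbM => //; exact: Ub_node].
suff E_small eta : 0 < eta -> `|E [::]| <= 4 * eta * v [::].
  apply/eqP; rewrite -normr_le0; apply/ler_addgt0Pl => e e0; rewrite addr0.
  have v1 : 0 < v [::] + 1 by rewrite ltr_wpDl.
  have := E_small (e / 4 / (v [::] + 1)); rewrite !divr_gt0// => /(_ isT) h.
  apply: (le_trans h); rewrite (_ : 4 * _ = e / (v [::] + 1)); last first.
    by field; rewrite gt_eqF.
  by rewrite -mulrA ler_piMr ?(ltW e0)// mulrC ler_pdivrMr// mul1r lerDl.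
move=> eta0.
have [d d0 fd] := ((UbP f).1 uf).2 _ eta0.
have [k rk] : exists k, 2 * rho k < d.
  have /cvgn_distP/(_ (d / 3)) := rho_cvg; rewrite divr_gt0// => /(_ isT)[k /(_ k (leqnn k)) rk].
  by exists k; move: rk; rewrite subr0 ler_norml; lra.
have leaf i s : size s = k -> `|E (i :: s)| <= 4 * eta * v (i :: s).
  move=> sk.
  (* the reference value of f on the support; both weights vanish when the
     support is empty *)
  pose c := if pselect (node_support q (i :: s) !=set0) is left h
    then f (sval (cid h)) else 0.
  have fc z y : node_support q (i :: s) z -> mdist z y <= rho (size s) -> `|f y - c| <= eta.
    move=> zT zy; rewrite /c; case: pselect => [h|[]]; last by exists z.
    case: cid => /= z0 z0T; rewrite distrC; apply: fd; apply: le_lt_trans rk.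
    have := node_support_diam z0T zT; rewrite -/(rho (size s)) -sk.
    by have := metric_triangle z0 z y; lra.
  have h1 := J_close i s c eta fc; have h2 := J'_close i s c eta fc.
  have h3 : `|L (fun x => f x * node q (i :: s) x) - c * L (node q (i :: s))|
      <= eta * v (i :: s).
    have un := Ub_node q (i :: s).
    have ufn : Ub S (fun x => f x * node q (i :: s) x) by exact: UbM.
    rewrite -linear_UbZ// -linear_UbB//; last exact: UbZ.
    set g := fun x => _.
    have ug : Ub S g by apply: UbB => //; exact: UbZ.
    (* rescaled by eta, g competes in the definition of v (i :: s) *)
    have -> : L g = eta * L (fun x => eta^-1 * g x).
      by rewrite linear_UbZ// mulrA divff ?gt_eqF// mul1r.
    rewrite normrM gtr0_norm// ler_pM2l//; apply: v_norm => [|x]; first exact: UbZ.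
    rewrite normrM gtr0_norm ?invr_gt0// ler_pdivrMl//.
    rewrite /g -mulrBl normrM (ger0_norm (node_ge0 _ _ _)).
    have [->|xT] := eqVneq (node q (i :: s) x) 0; first by rewrite !mulr0.
    rewrite ler_wpM2r ?node_ge0//; apply: (fc x) => //.
    by rewrite mdistxx /rho mulr_ge0// ltW// radius_gt0.
  have h4 := v'_le (i :: s).
  have h5 : eta * v' (i :: s) <= eta * (2 * v (i :: s)) by rewrite ler_pM2l.
  rewrite /E; move: h1 h2 h3 h5; rewrite !ler_norml /v'.
  lra.
have up n s : (size s + n = k.+1)%N -> `|E s| <= 4 * eta * v s.
  elim: n s => [|n IH] s.
    by case: s => // i s /=; rewrite addn0 => -[sk]; exact: leaf.
  rewrite addnS => -[sn].
  apply: (@cvgn_le _ (fun N => `|series (fun i => E (i :: s)) N|)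
    (fun N => 4 * eta * series (fun i => v (i :: s)) N)).
  - by apply: cvg_norm; exact: E_series.
  - by apply: cvgM; [exact: cvg_cst|exact: v_series].
  - move=> N; apply: le_trans (ler_norm_sum _ _ _) _.
    rewrite /series/= mulr_sumr; apply: ler_sum => i _; apply: IH => /=.
    by rewrite addSn sn.
exact: (up k.+1).
Qed.

End pairing_representation.

Lemma dense_sequence (R : realType) (S : completeMetricType R) : separable S ->
  exists q : nat -> S, forall x (e : R), 0 < e -> exists n, mdist x (q n) < e.
Proof.
move=> [D /countable_injP[h hinj] Ddense].
exists (fun n => xget point [set x | D x /\ h x = n]) => x e e0.
have [|y [xy Dy]] := Ddense (ball x e)^° _ (open_interior _).
  by exists x; apply: nbhsx_ballx.
exists (h y).
have : [set x | D x /\ h x = h y] (xget point [set x | D x /\ h x = h y]).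
  by apply: (@xgetPex _ _ _); exists y.
move=> [Dz hz].
have -> : xget point [set x | D x /\ h x = h y] = y.
  by apply: hinj; rewrite ?inE.
by have := interior_subset xy; rewrite ballEmdist.
Qed.

Theorem corollary3p1 (R : realType) (S : completeMetricType R)
    (S_separable : separable S) (mu_ : nat -> signed_measure S)
    (mu_cauchy : forall f : S -> R, Ub S f ->
       cauchy (pairing (mu_ n) f @[n --> \oo])) :
  exists mu : signed_measure S,
    forall f : S -> R, Ub S f ->
      pairing (mu_ n) f @[n --> \oo] --> pairing mu f.
Proof.
pose L f := limn (fun n => pairing (mu_ n) f).
have mu_cvg f : Ub S f -> pairing (mu_ n) f @[n --> \oo] --> L f.
  by move=> /mu_cauchy/cauchy_cvg.
have lin n := @linear_pairing _ _ (mu_ n); have smo n := @smooth_pairing _ _ (mu_ n).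
have [C LC] := limit_bounded lin smo mu_cvg.
have [q qdense] := dense_sequence S_separable.
have L_series r f (r0 : 0 < r) := limit_piece_series r0 qdense lin smo mu_cvg (f := f).
have [mu hmu] := pairing_representation (linear_Ub_limit lin mu_cvg) LC L_series.
by exists mu => f uf; rewrite -hmu//; exact: mu_cvg.
Qed.
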